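(* Let $\#,\hat\#\colon\mathbf C\times(\mathbf C\times\mathbf D)\to\mathbf C$ be guarded parametrized monads, with $\#$ guarded pre-iterative, and let $\rho\colon\#\to\hat\#$ be a parametrized guarded monad morphism that is an iteration-congruent retraction. Let $X\#^\nu Z=\nu\gamma.\,X\#(\gamma,Z)$ and $X\hat\#^\nu Z=\nu\gamma.\,X\hat\#(\gamma,Z)$ be the induced guarded parametrized monads (assuming these final coalgebras exist). Then $\rho^\nu\colon\#^\nu\to\hat\#^\nu$ with components $\rho^\nu_{X,Z}=\mathrm{coit}\big(\rho_{X,(X\#^\nu Z,Z)}\circ\mathrm{out}\big)\colon X\#^\nu Z\to X\hat\#^\nu Z$ is again an iteration-congruent retraction.
   Context: A parametrized monad is a bifunctor $\#\colon\mathbf C\times\mathbf E\to\mathbf C$ such that each $(-)\#P$ is a monad (unit $\eta$, lifting $(-)^*$) and each $\mathrm{id}\#p$ is a monad morphism. Summands $\sigma$ of $Y$: pairs of morphisms exhibiting $Y$ as a coproduct; $\bar\sigma$ complement. A monad $M$ is guarded if equipped with a relation $f\colon X\to_\sigma MY$ closed under (trv) $M(\mathrm{inl})\circ f\colon X\to_{\mathrm{inr}}M(Y+Z)$; (par) $f\colon X\to_\sigma MZ$, $g\colon Y\to_\sigma MZ$ imply $[f,g]\colon X+Y\to_\sigma MZ$; (cmp) $f\colon X\to_{\mathrm{inr}}M(Y+Z)$, $g\colon Y\to_\sigma MV$, $h\colon Z\to MV$ imply $[g,h]^*\circ f\colon X\to_\sigma MV$. Guarded pre-iterative: operator assigning to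 $f\colon X\to_{\mathrm{inr}}M(Y+X)$ some $f^\dagger$ with $f^\dagger=[\eta,f^\dagger]^*\circ f$. A parametrized guarded (pre-iterative) monad has all $(-)\#P$ guarded (pre-iterative) and all $\mathrm{id}\#p$ guarded (and iteration-preserving: $(\mathrm{id}\#p)\circ g^\dagger=((\mathrm{id}\#p)\circ g)^\dagger$). A parametrized guarded monad morphism is a natural transformation whose components $\rho_{-,P}$ are guarded monad morphisms. A guarded retraction $\rho\colon\mathbb T\to\mathbb S$ is a monad morphism with a family $\upsilon_X\colon SX\to TX$, $\rho\circ\upsilon=\mathrm{id}$, with $f\colon X\to_\sigma SY$ implying $\upsilon\circ f\colon X\to_\sigma TY$; an iteration congruence satisfies $\rho\circ f=\rho\circ g\Rightarrow\rho\circ f^\dagger=\rho\circ g^\dagger$ for $f,g\colon X\to_{\mathrm{inr}}T(Y+X)$; a parametrized morphism is such if all its components $\rho_{-,P}$ are. On $\#^\nu$ ($\mathrm{out}\colon X\#^\nu Z\to X\#(X\#^\nu Z,Z)$, coiteration $\mathrm{coit}$): unit $\eta^\nu$ with $\mathrm{out}\circ\eta^\nu=\eta$; the Kleisli lifting is the one making $\#^\nu$ a monad for each $Z$ (for $f\colon X\to Y\#^\nu Z$, $f^\ddagger$ is the unique map with $[f^\ddagger,\mathrm{id}]$ a coalgebra morphism from $[\bar f^*\circ(\mathrm{id}\#(\mathrm{inl},\mathrm{id}))\circ\mathrm{out},(\mathrm{id}\#(\mathrm{inr},\mathrm{id}))\circ\mathrm{out}]$ to $\mathrm{out}$, where $\bar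 f=(\mathrm{id}\#(\mathrm{inr},\mathrm{id}))\circ\mathrm{out}\circ f$). Guardedness: $f\colon X\to Y\#^\nu Z$ is $\sigma$-guarded iff $\mathrm{out}\circ f$ is $\sigma$-guarded. Iteration: for $f\colon X\to_{\mathrm{inr}}(Y+X)\#^\nu Z$, $f^{\dagger\dagger}=\mathrm{coit}([\eta,(\mathrm{out}\circ f)^\dagger]^*\circ\mathrm{out})\circ\eta^\nu\circ\mathrm{inr}$. The same applies to $\hat\#^\nu$. *)

(* Defs.v *)
From Corelib Require Import ssreflect ssrfun.

Set Implicit Arguments.
Unset Strict Implicit.
Unset Printing Implicit Defensive.

Declare Scope cat_scope.
Delimit Scope cat_scope with cat.
Local Open Scope cat_scope.

Record category := Category {
  ob :> Type;
  hom : ob -> ob -> Type;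
  idm : forall X, hom X X;
  comp : forall X Y Z, hom Y Z -> hom X Y -> hom X Z;
  comp1m : forall X Y (f : hom X Y), comp (idm Y) f = f;
  compm1 : forall X Y (f : hom X Y), comp f (idm X) = f;
  compA : forall X Y Z W (h : hom Z W) (g : hom Y Z) (f : hom X Y),
    comp h (comp g f) = comp (comp h g) f
}.

Arguments hom {c} X Y.
Arguments idm {c} X.
Arguments comp {c X Y Z} g f.

Notation "g \c f" := (comp g f) (at level 40, left associativity) : cat_scope.

Record functor (C D : category) := Functor {
  fobj :> C -> D;
  fmap : forall X Y : C, hom X Y -> hom (fobj X) (fobj Y);
  fmap_id : forall X, fmap (idm X) = idm (fobj X);
  fmap_comp : forall X Y Z (g : hom Y Z) (f : hom X Y),
    fmap (g \c f) = fmap g \c fmap f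
}.

Arguments fmap {C D} f {X Y} _ : rename.

Program Definition prod_cat (C D : category) : category :=
  @Category (C * D)
    (fun P Q => (hom P.1 Q.1 * hom P.2 Q.2)%type)
    (fun P => (idm P.1, idm P.2))
    (fun P Q R g f => (g.1 \c f.1, g.2 \c f.2)) _ _ _.
Next Obligation. by move=> C D X Y [f g]; rewrite /= !comp1m. Qed.
Next Obligation. by move=> C D X Y [f g]; rewrite /= !compm1. Qed.
Next Obligation. by move=> *; rewrite /= !compA. Qed.

Definition pairm (C D : category) (A B : C) (Z W : D)
    (g : hom A B) (z : hom Z W) : @hom (prod_cat C D) (A, Z) (B, W) := (g, z).

Definition bimap (C E D : category) (F : functor (prod_cat C E) D)
    (X Y : C) (P Q : E) (f : hom X Y) (p : hom P Q) :
    hom (F (X, P)) (F (Y, Q)) := fmap F (pairm f p).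

Lemma bimap_id (C E D : category) (F : functor (prod_cat C E) D) X P :
  bimap F (idm X) (idm P) = idm (F (X, P)).
Proof. exact: (fmap_id F (X, P)). Qed.

Lemma bimap_comp (C E D : category) (F : functor (prod_cat C E) D)
    (X Y V : C) (P Q R : E) (f' : hom Y V) (p' : hom Q R)
    (f : hom X Y) (p : hom P Q) :
  bimap F f' p' \c bimap F f p = bimap F (f' \c f) (p' \c p).
Proof. by rewrite /bimap -fmap_comp. Qed.

Definition is_coproduct (C : category) (A B Y : C) (i : hom A Y) (j : hom B Y) :=
  forall (Z : C) (f : hom A Z) (g : hom B Z),
    exists! h : hom Y Z, h \c i = f /\ h \c j = g.

(* Categories with chosen binary coproducts. *)
Record cocat := CoCat {
  cocat_cat :> category;
  cop : cocat_cat -> cocat_cat -> cocat_cat;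
  injl : forall X Y, hom X (cop X Y);
  injr : forall X Y, hom Y (cop X Y);
  copair : forall X Y Z, hom X Z -> hom Y Z -> hom (cop X Y) Z;
  copair_injl : forall X Y Z (f : hom X Z) (g : hom Y Z),
    copair f g \c injl X Y = f;
  copair_injr : forall X Y Z (f : hom X Z) (g : hom Y Z),
    copair f g \c injr X Y = g;
  copair_uniq : forall X Y Z (f : hom X Z) (g : hom Y Z) (h : hom (cop X Y) Z),
    h \c injl X Y = f -> h \c injr X Y = g -> h = copair f g
}.

Arguments cop {c} X Y.
Arguments injl {c X Y}.
Arguments injr {c X Y}.
Arguments copair {c X Y Z} f g.

(* A summand carries a chosen complement, complements need not be unique. *)
Record summand (C : category) (Y : C) := Summand {
  smd_dom : C;
  smd_codom : C;
  smd_inj : hom smd_dom Y;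
  smd_compl : hom smd_codom Y;
  smdP : is_coproduct smd_inj smd_compl
}.

Lemma injr_is_coproduct (C : cocat) (X Y : C) :
  is_coproduct (@injr C X Y) (@injl C X Y).
Proof.
move=> Z f g; exists (copair g f); split.
  by rewrite copair_injl copair_injr.
by move=> h [hf hg]; rewrite (copair_uniq hg hf).
Qed.

Definition inr_smd (C : cocat) (X Y : C) : summand (cop X Y) :=
  Summand (@injr_is_coproduct C X Y).

Record monad_on (C : category) (M : C -> C) := MonadOn {
  eta_on : forall X, hom X (M X);
  lift_on : forall X Y, hom X (M Y) -> hom (M X) (M Y);
  lift_eta_on : forall X, lift_on (eta_on X) = idm (M X);
  lift_comp_eta_on : forall X Y (f : hom X (M Y)), lift_on f \c eta_on X = f;
  lift_comp_on : forall X Y Z (g : hom Y (M Z)) (f : hom X (M Y)),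
    lift_on (lift_on g \c f) = lift_on g \c lift_on f
}.

Record monad (C : category) := Monad {
  mobj :> C -> C;
  monad_str : monad_on mobj
}.

Definition eta (C : category) (M : monad C) (X : C) : hom X (M X) :=
  eta_on (monad_str M) X.
Definition lift (C : category) (M : monad C) (X Y : C) (f : hom X (M Y)) :
  hom (M X) (M Y) := lift_on (monad_str M) f.
Arguments eta {C} M {X}.
Arguments lift {C} M {X Y} f.

Lemma lift_eta (C : category) (M : monad C) (X : C) :
  lift M (eta M) = idm (M X).
Proof. exact: lift_eta_on. Qed.
Lemma lift_comp_eta (C : category) (M : monad C) (X Y : C) (f : hom X (M Y)) :
  lift M f \c eta M = f.
Proof. exact: lift_comp_eta_on. Qed.
Lemma lift_comp (C : category) (M : monad C) (X Y Z : C)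
    (g : hom Y (M Z)) (f : hom X (M Y)) :
  lift M (lift M g \c f) = lift M g \c lift M f.
Proof. exact: lift_comp_on. Qed.

Definition mmap (C : category) (M : monad C) (X Y : C) (f : hom X Y) :
  hom (M X) (M Y) := lift M (eta M \c f).

Definition is_monad_morphism (C : category) (T S : monad C)
    (alpha : forall X, hom (T X) (S X)) : Prop :=
  (forall X, alpha X \c eta T = eta S) /\
  (forall X Y (f : hom X (T Y)),
     alpha Y \c lift T f = lift S (alpha Y \c f) \c alpha X).

Record guarded_on (C : cocat) (M : monad C) := GuardedOn {
  grd_on : forall X Y : C, summand Y -> hom X (M Y) -> Prop;
  grd_trv_on : forall (X Y Z : C) (f : hom X (M Y)),
    grd_on (inr_smd Y Z) (mmap M injl \c f);
  grd_par_on : forall (X Y Z : C) (s : summand Z)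
      (f : hom X (M Z)) (g : hom Y (M Z)),
    grd_on s f -> grd_on s g -> grd_on s (copair f g);
  grd_cmp_on : forall (X Y Z V : C) (s : summand V)
      (f : hom X (M (cop Y Z))) (g : hom Y (M V)) (h : hom Z (M V)),
    grd_on (inr_smd Y Z) f -> grd_on s g ->
    grd_on s (lift M (copair g h) \c f)
}.

Record guarded_monad (C : cocat) := GuardedMonad {
  gmonad :> monad C;
  guarded_str : guarded_on gmonad
}.

Definition grd (C : cocat) (M : guarded_monad C) (X Y : C) (s : summand Y)
  (f : hom X (M Y)) : Prop := grd_on (guarded_str M) s f.
Arguments grd {C} M {X Y} s f.

Definition is_guarded_monad_morphism (C : cocat) (T S : guarded_monad C)
    (alpha : forall X, hom (T X) (S X)) : Prop :=
  is_monad_morphism alpha /\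
  (forall (X Y : C) (s : summand Y) (f : hom X (T Y)),
     grd T s f -> grd S s (alpha Y \c f)).

(* The family upsilon is not required to be natural. *)
Definition is_guarded_retraction (C : cocat) (T S : guarded_monad C)
    (rho : forall X, hom (T X) (S X)) : Prop :=
  is_monad_morphism rho /\
  exists upsilon : forall X, hom (S X) (T X),
    (forall X, rho X \c upsilon X = idm (S X)) /\
    (forall (X Y : C) (s : summand Y) (f : hom X (S Y)),
       grd S s f -> grd T s (upsilon Y \c f)).

(* The operator is partial, hence takes a guardedness proof; [dag_irr_on] says
   that the result depends on the morphism only. *)
Record preiterative_on (C : cocat) (M : guarded_monad C) := PreiterativeOn {
  dag_on : forall (X Y : C) (f : hom X (M (cop Y X))),
    grd M (inr_smd Y X) f -> hom X (M Y);
  dag_irr_on : forall (X Y : C) (f : hom X (M (cop Y X)))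
    (H H' : grd M (inr_smd Y X) f), dag_on H = dag_on H';
  dag_fix_on : forall (X Y : C) (f : hom X (M (cop Y X)))
    (H : grd M (inr_smd Y X) f),
    dag_on H = lift M (copair (eta M) (dag_on H)) \c f
}.

Record preiterative_monad (C : cocat) := PreiterativeMonad {
  pimonad :> guarded_monad C;
  preiterative_str : preiterative_on pimonad
}.

Definition dag (C : cocat) (M : preiterative_monad C) (X Y : C)
  (f : hom X (M (cop Y X))) (H : grd M (inr_smd Y X) f) : hom X (M Y) :=
  dag_on (preiterative_str M) H.
Arguments dag {C} M {X Y f} H.

Lemma dag_irr (C : cocat) (M : preiterative_monad C) (X Y : C)
    (f : hom X (M (cop Y X))) (H H' : grd M (inr_smd Y X) f) :
  dag M H = dag M H'.
Proof. exact: dag_irr_on. Qed.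

Lemma dag_fix (C : cocat) (M : preiterative_monad C) (X Y : C)
    (f : hom X (M (cop Y X))) (H : grd M (inr_smd Y X) f) :
  dag M H = lift M (copair (eta M) (dag M H)) \c f.
Proof. exact: dag_fix_on. Qed.

Definition preserves_iteration (C : cocat) (T S : preiterative_monad C)
    (alpha : forall X, hom (T X) (S X)) : Prop :=
  forall (X Y : C) (f : hom X (T (cop Y X)))
    (H : grd T (inr_smd Y X) f)
    (H' : grd S (inr_smd Y X) (alpha (cop Y X) \c f)),
    alpha Y \c dag T H = dag S H'.

Definition is_iteration_congruence (C : cocat) (T : preiterative_monad C)
    (S : guarded_monad C) (rho : forall X, hom (T X) (S X)) : Prop :=
  forall (X Y : C) (f g : hom X (T (cop Y X)))
    (Hf : grd T (inr_smd Y X) f) (Hg : grd T (inr_smd Y X) g),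
    rho (cop Y X) \c f = rho (cop Y X) \c g ->
    rho Y \c dag T Hf = rho Y \c dag T Hg.

(* [pm_mapE] states that the action of the bifunctor in its first argument is
   the functor action of the monads. *)
Record param_monad (C E : category) := ParamMonad {
  pm_fun :> functor (prod_cat C E) C;
  pm_str : forall P : E, monad_on (fun X => pm_fun (X, P));
  pm_at := (fun P => Monad (pm_str P)) : E -> monad C;
  pm_mapE : forall (X Y : C) (P : E) (f : hom X Y),
    bimap pm_fun f (idm P) = mmap (pm_at P) f;
  pm_morph : forall (P Q : E) (p : hom P Q),
    @is_monad_morphism C (pm_at P) (pm_at Q)
      (fun X => bimap pm_fun (idm X) p)
}.

Record param_guarded_monad (C : cocat) (E : category) := ParamGuardedMonad {
  pgm_pm :> param_monad C E;
  pgm_str : forall P : E, guarded_on (pm_at pgm_pm P);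
  pgm_at := (fun P => GuardedMonad (pgm_str P)) : E -> guarded_monad C;
  pgm_morph : forall (P Q : E) (p : hom P Q),
    @is_guarded_monad_morphism C (pgm_at P) (pgm_at Q)
      (fun X => bimap pgm_pm (idm X) p)
}.

Record param_preiterative_monad (C : cocat) (E : category) :=
  ParamPreiterativeMonad {
  ppm_pgm :> param_guarded_monad C E;
  ppm_str : forall P : E, preiterative_on (pgm_at ppm_pgm P);
  ppm_at := (fun P => PreiterativeMonad (ppm_str P)) :
    E -> preiterative_monad C;
  ppm_morph : forall (P Q : E) (p : hom P Q),
    @preserves_iteration C (ppm_at P) (ppm_at Q)
      (fun X => bimap ppm_pgm (idm X) p)
}.

Definition is_param_guarded_monad_morphism (C : cocat) (E : category)
    (T S : param_guarded_monad C E)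
    (rho : forall (X : C) (P : E), hom (T (X, P)) (S (X, P))) : Prop :=
  (forall (X Y : C) (P Q : E) (f : hom X Y) (p : hom P Q),
     rho Y Q \c bimap T f p = bimap S f p \c rho X P) /\
  (forall P : E,
     @is_guarded_monad_morphism C (pgm_at T P) (pgm_at S P)
       (fun X => rho X P)).

Definition is_param_guarded_retraction (C : cocat) (E : category)
    (T S : param_guarded_monad C E)
    (rho : forall (X : C) (P : E), hom (T (X, P)) (S (X, P))) : Prop :=
  forall P : E,
    @is_guarded_retraction C (pgm_at T P) (pgm_at S P) (fun X => rho X P).

Definition is_param_iteration_congruence (C : cocat) (E : category)
    (T : param_preiterative_monad C E) (S : param_guarded_monad C E)
    (rho : forall (X : C) (P : E), hom (T (X, P)) (S (X, P))) : Prop :=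
  forall P : E,
    @is_iteration_congruence C (ppm_at T P) (pgm_at S P) (fun X => rho X P).

Definition is_coalg_morphism (C : category) (F : functor C C) (A B : C)
    (a : hom A (F A)) (b : hom B (F B)) (h : hom A B) : Prop :=
  b \c h = fmap F h \c a.

Record final_coalgebra (C : category) (F : functor C C) := FinalCoalgebra {
  fc_ob :> C;
  out : hom fc_ob (F fc_ob);
  coit : forall A : C, hom A (F A) -> hom A fc_ob;
  coitP : forall (A : C) (a : hom A (F A)), is_coalg_morphism a out (coit a);
  coit_uniq : forall (A : C) (a : hom A (F A)) (h : hom A fc_ob),
    is_coalg_morphism a out h -> h = coit a
}.

Arguments out {C F} f.
Arguments coit {C F} f {A} a.

(* The functor [gamma |-> X # (gamma, Z)]. *)
Program Definition gamma_functor (C D : category)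
    (T : functor (prod_cat C (prod_cat C D)) C) (X : C) (Z : D) :
    functor C C :=
  @Functor C C (fun G => T (X, (G, Z)))
    (fun G H g => bimap T (idm X) (pairm g (idm Z))) _ _.
Next Obligation. by move=> *; exact: bimap_id. Qed.
Next Obligation.
by move=> *; rewrite bimap_comp /pairm /= !comp1m.
Qed.

Lemma pairm_comp (C D : category) (A B G : C) (Z W V : D)
    (g' : hom B G) (z' : hom W V) (g : hom A B) (z : hom Z W) :
  pairm g' z' \c pairm g z = pairm (g' \c g) (z' \c z).
Proof. by []. Qed.

Definition final_coalgebras (C D : category)
    (T : functor (prod_cat C (prod_cat C D)) C) : Type :=
  forall (X : C) (Z : D), final_coalgebra (gamma_functor T X Z).

Section NuFunctor.
Context (C D : category) (T : functor (prod_cat C (prod_cat C D)) C).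
Context (nu : final_coalgebras T).

Definition nu_out (X : C) (Z : D) : hom (nu X Z) (T (X, (nu X Z : C, Z))) :=
  out (nu X Z).

Definition nu_coit (X : C) (Z : D) (A : C) (a : hom A (T (X, (A, Z)))) :
  hom A (nu X Z) := @coit _ _ (nu X Z) A a.

Lemma nu_coitE (X : C) (Z : D) (A : C) (a : hom A (T (X, (A, Z)))) :
  nu_out X Z \c nu_coit a =
  bimap T (idm X) (pairm (nu_coit a) (idm Z)) \c a.
Proof. exact: (@coitP _ _ (nu X Z) A a). Qed.

Lemma nu_coit_uniq (X : C) (Z : D) (A : C) (a : hom A (T (X, (A, Z))))
    (h : hom A (nu X Z)) :
  nu_out X Z \c h = bimap T (idm X) (pairm h (idm Z)) \c a -> h = nu_coit a.
Proof. exact: (@coit_uniq _ _ (nu X Z) A a h). Qed.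

Lemma nu_coit_eq (X : C) (Z : D) (A : C) (a : hom A (T (X, (A, Z))))
    (h k : hom A (nu X Z)) :
  nu_out X Z \c h = bimap T (idm X) (pairm h (idm Z)) \c a ->
  nu_out X Z \c k = bimap T (idm X) (pairm k (idm Z)) \c a -> h = k.
Proof. by move=> /nu_coit_uniq -> /nu_coit_uniq ->. Qed.

Definition nu_in (X : C) (Z : D) : hom (T (X, (nu X Z : C, Z))) (nu X Z) :=
  nu_coit (bimap T (idm X) (pairm (nu_out X Z) (idm Z))).

Lemma nu_outK (X : C) (Z : D) : nu_in X Z \c nu_out X Z = idm _.
Proof.
apply: (@nu_coit_eq _ _ _ (nu_out X Z)).
  by rewrite compA nu_coitE bimap_comp pairm_comp !comp1m.
by rewrite bimap_id comp1m compm1.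
Qed.

Lemma nu_inK (X : C) (Z : D) : nu_out X Z \c nu_in X Z = idm _.
Proof.
by rewrite nu_coitE bimap_comp pairm_comp !comp1m -/(nu_in X Z) nu_outK bimap_id.
Qed.

Lemma nu_out_inj (X : C) (Z : D) (A : C) (f g : hom A (nu X Z)) :
  nu_out X Z \c f = nu_out X Z \c g -> f = g.
Proof.
by move=> e; rewrite -[f]comp1m -[g]comp1m -nu_outK -!compA e.
Qed.

Definition nu_map (X Y : C) (Z W : D) (f : hom X Y) (z : hom Z W) :
  hom (nu X Z) (nu Y W) :=
  nu_coit (bimap T f (pairm (idm _) z) \c nu_out X Z).

Lemma nu_mapE (X Y : C) (Z W : D) (f : hom X Y) (z : hom Z W) :
  nu_out Y W \c nu_map f z =
  bimap T f (pairm (nu_map f z) z) \c nu_out X Z.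
Proof.
by rewrite nu_coitE compA bimap_comp pairm_comp !comp1m compm1.
Qed.

Lemma nu_map_uniq (X Y : C) (Z W : D) (f : hom X Y) (z : hom Z W)
    (h : hom (nu X Z) (nu Y W)) :
  nu_out Y W \c h = bimap T f (pairm h z) \c nu_out X Z -> h = nu_map f z.
Proof.
move=> e; apply: nu_coit_uniq; rewrite e.
by rewrite compA bimap_comp pairm_comp !comp1m compm1.
Qed.

Program Definition nu_functor : functor (prod_cat C D) C :=
  @Functor (prod_cat C D) C (fun P => nu P.1 P.2)
    (fun P Q f => nu_map f.1 f.2) _ _.
Next Obligation.
by move=> [X Z]; apply/esym/nu_map_uniq; rewrite bimap_id comp1m compm1.
Qed.
Next Obligation.
move=> *; apply/esym/nu_map_uniq => /=.
by rewrite compA nu_mapE -compA nu_mapE compA bimap_comp pairm_comp.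
Qed.

End NuFunctor.

Section NuMonad.
Context (C : cocat) (D : category) (T : param_monad C (prod_cat C D)).
Context (nu : final_coalgebras T).

Local Notation TT G Z := (pm_at T (@pair (ob C) (ob D) G Z)).

(* The unit is the map with [out \c nu_eta = eta], see [nu_etaE]. *)
Definition nu_eta (Z : D) (X : C) : hom X (nu X Z) :=
  nu_in nu X Z \c eta (TT (nu X Z) Z).

Lemma nu_etaE (Z : D) (X : C) :
  nu_out nu X Z \c nu_eta Z X = eta (TT (nu X Z) Z).
Proof. by rewrite /nu_eta compA nu_inK comp1m. Qed.

Section Lift.
Context (Z : D) (X Y : C) (f : hom X (nu Y Z)).

Definition nu_lift_bar : hom X (TT (cop (nu X Z : C) (nu Y Z)) Z Y) :=
  bimap T (idm Y) (pairm injr (idm Z)) \c (nu_out nu Y Z \c f).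

Definition nu_lift_coalg :
    hom (cop (nu X Z : C) (nu Y Z)) (TT (cop (nu X Z : C) (nu Y Z)) Z Y) :=
  copair
    (lift (TT (cop (nu X Z : C) (nu Y Z)) Z) nu_lift_bar \c
       (bimap T (idm X) (pairm injl (idm Z)) \c nu_out nu X Z))
    (bimap T (idm Y) (pairm injr (idm Z)) \c nu_out nu Y Z).

(* The map such that [[nu_lift, id]] is a coalgebra morphism from
   [nu_lift_coalg] to [out], see [nu_liftP] and [nu_lift_uniq]. *)
Definition nu_lift : hom (nu X Z) (nu Y Z) :=
  @nu_coit C D T nu Y Z _ nu_lift_coalg \c injl.

End Lift.

Lemma cop_eq (X Y V : C) (h k : hom (cop X Y) V) :
  h \c injl = k \c injl -> h \c injr = k \c injr -> h = k.
Proof. by move=> el er; rewrite (copair_uniq el er) -(copair_uniq erefl erefl). Qed.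

Lemma comp_copair (X Y V W : C) (h : hom V W) (f : hom X V) (g : hom Y V) :
  h \c copair f g = copair (h \c f) (h \c g).
Proof. by apply: copair_uniq; rewrite -compA ?copair_injl ?copair_injr. Qed.

Lemma bimap_lift (V W : C) (P Q : prod_cat C D)
    (p : hom P Q) (k : hom V (T (W, P))) :
  bimap T (idm W) p \c lift (pm_at T P) k =
  lift (pm_at T Q) (bimap T (idm W) p \c k) \c bimap T (idm V) p.
Proof. by case: (pm_morph T p) => _ ->. Qed.

Lemma bimap_eta (V : C) (P Q : prod_cat C D) (p : hom P Q) :
  bimap T (idm V) p \c eta (pm_at T P) = eta (pm_at T Q).
Proof. by case: (pm_morph T p) => ->. Qed.

(* Equivalent one-step form of the coalgebra morphism condition. *)
Lemma nu_lift_coalgP (Z : D) (X Y : C) (f : hom X (nu Y Z))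
    (h : hom (nu X Z) (nu Y Z)) :
  is_coalg_morphism (F := gamma_functor T Y Z) (nu_lift_coalg f)
    (nu_out nu Y Z) (copair h (idm _)) <->
  nu_out nu Y Z \c h =
  lift (TT (nu Y Z) Z) (nu_out nu Y Z \c f) \c
    (bimap T (idm X) (pairm h (idm Z)) \c nu_out nu X Z).
Proof.
rewrite /is_coalg_morphism /=.
have El : bimap T (idm Y) (pairm (copair h (idm _)) (idm Z)) \c
    nu_lift_coalg f \c injl = lift (TT (nu Y Z) Z) (nu_out nu Y Z \c f) \c
    (bimap T (idm X) (pairm h (idm Z)) \c nu_out nu X Z).
  rewrite -compA copair_injl compA bimap_lift compA -[X in X \c _]compA.
  rewrite !bimap_comp !pairm_comp copair_injl !comp1m.
  by rewrite /nu_lift_bar compA bimap_comp pairm_comp copair_injr !comp1m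
             bimap_id comp1m compA.
have Er : bimap T (idm Y) (pairm (copair h (idm _)) (idm Z)) \c
    nu_lift_coalg f \c injr = nu_out nu Y Z.
  rewrite -compA copair_injr compA bimap_comp pairm_comp copair_injr.
  by rewrite !comp1m bimap_id comp1m.
split=> [e|e]; first by rewrite -El -e -compA copair_injl.
by apply: cop_eq; rewrite ?El ?Er -compA ?copair_injl ?copair_injr ?compm1.
Qed.

Lemma nu_lift_uniq (Z : D) (X Y : C) (f : hom X (nu Y Z))
    (h : hom (nu X Z) (nu Y Z)) :
  is_coalg_morphism (F := gamma_functor T Y Z) (nu_lift_coalg f)
    (nu_out nu Y Z) (copair h (idm _)) -> h = nu_lift f.
Proof.
by move=> /nu_coit_uniq e; rewrite /nu_lift -e copair_injl.
Qed.

Lemma nu_liftP (Z : D) (X Y : C) (f : hom X (nu Y Z)) :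
  is_coalg_morphism (F := gamma_functor T Y Z) (nu_lift_coalg f)
    (nu_out nu Y Z) (copair (nu_lift f) (idm _)).
Proof.
have -> : copair (nu_lift f) (idm _) = nu_coit nu (nu_lift_coalg f).
  apply/esym/copair_uniq => //; apply: (@nu_coit_eq _ _ _ nu _ _ _ (nu_out nu Y Z)).
    rewrite compA nu_coitE -compA copair_injr compA bimap_comp pairm_comp.
    by rewrite !comp1m.
  by rewrite bimap_id comp1m compm1.
exact: nu_coitE.
Qed.

Lemma nu_liftE (Z : D) (X Y : C) (f : hom X (nu Y Z)) :
  nu_out nu Y Z \c nu_lift f =
  lift (TT (nu Y Z) Z) (nu_out nu Y Z \c f) \c
    (bimap T (idm X) (pairm (nu_lift f) (idm Z)) \c nu_out nu X Z).
Proof. exact/nu_lift_coalgP/nu_liftP. Qed.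

Lemma nu_lift_uniq1 (Z : D) (X Y : C) (f : hom X (nu Y Z))
    (h : hom (nu X Z) (nu Y Z)) :
  nu_out nu Y Z \c h =
  lift (TT (nu Y Z) Z) (nu_out nu Y Z \c f) \c
    (bimap T (idm X) (pairm h (idm Z)) \c nu_out nu X Z) -> h = nu_lift f.
Proof. by move=> /nu_lift_coalgP/nu_lift_uniq. Qed.

Lemma nu_corec_eq (W : D) (X Y A : C) (a : hom X (TT (nu Y W) W Y))
    (b : hom A (TT A W X)) (h k : hom A (nu Y W)) :
  nu_out nu Y W \c h = lift (TT (nu Y W) W) a \c
    (bimap T (idm X) (pairm h (idm W)) \c b) ->
  nu_out nu Y W \c k = lift (TT (nu Y W) W) a \c
    (bimap T (idm X) (pairm k (idm W)) \c b) -> h = k.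
Proof.
pose B := cop A (nu Y W).
pose c : hom B (TT B W Y) := copair
    (lift (TT B W) (bimap T (idm Y) (pairm injr (idm W)) \c a) \c
       (bimap T (idm X) (pairm injl (idm W)) \c b))
    (bimap T (idm Y) (pairm injr (idm W)) \c nu_out nu Y W).
have E l : nu_out nu Y W \c l = lift (TT (nu Y W) W) a \c
    (bimap T (idm X) (pairm l (idm W)) \c b) ->
    copair l (idm _) = nu_coit nu c.
  move=> e; apply: nu_coit_uniq; apply: cop_eq; rewrite -!compA
    ?copair_injl ?copair_injr compA.
    rewrite bimap_lift [X in lift _ X]compA bimap_comp pairm_comp copair_injr.
    rewrite !comp1m bimap_id comp1m -!compA [bimap _ _ _ \c (_ \c b)]compA.
    by rewrite bimap_comp pairm_comp copair_injl !comp1m.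
  by rewrite bimap_comp pairm_comp copair_injr !comp1m bimap_id comp1m compm1.
move=> /E eh /E ek.
by rewrite -(copair_injl h (idm _)) eh -ek copair_injl.
Qed.

Lemma nu_lift_eta (Z : D) (X : C) : nu_lift (nu_eta Z X) = idm (nu X Z).
Proof.
apply/esym/nu_lift_uniq1.
by rewrite nu_etaE lift_eta bimap_id !comp1m compm1.
Qed.

Lemma nu_lift_comp_eta (Z : D) (X Y : C) (f : hom X (nu Y Z)) :
  nu_lift f \c nu_eta Z X = f.
Proof.
apply: nu_out_inj; rewrite compA nu_liftE -!compA nu_etaE.
by rewrite bimap_eta lift_comp_eta.
Qed.

Lemma nu_lift_comp (Z : D) (X Y V : C) (g : hom Y (nu V Z))
    (f : hom X (nu Y Z)) :
  nu_lift (nu_lift g \c f) = nu_lift g \c nu_lift f.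
Proof.
apply/esym/nu_lift_uniq1.
move: (nu_lift g) (nu_liftE g) (nu_lift f) (nu_liftE f) => gl glE fl flE.
have -> : nu_out nu V Z \c (gl \c f) =
    lift (TT (nu V Z) Z) (nu_out nu V Z \c g) \c
    (bimap T (idm Y) (pairm gl (idm Z)) \c (nu_out nu Y Z \c f)).
  by rewrite compA glE -!compA.
rewrite compA glE -!compA flE lift_comp -!compA; congr (_ \c _).
rewrite [LHS]compA bimap_lift -!compA; congr (_ \c _).
by rewrite [LHS]compA bimap_comp pairm_comp !comp1m.
Qed.

Definition nu_monad_on (Z : D) : monad_on (fun X => nu_functor nu (X, Z)) :=
  @MonadOn C (fun X => nu_functor nu (X, Z)) (nu_eta Z)
    (fun X Y => @nu_lift Z X Y) (@nu_lift_eta Z) (@nu_lift_comp_eta Z)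
    (@nu_lift_comp Z).

Lemma nu_bimapE (X Y : C) (Z W : D) (f : hom X Y) (z : hom Z W) :
  nu_out nu Y W \c bimap (nu_functor nu) f z =
  bimap T f (pairm (bimap (nu_functor nu) f z) z) \c nu_out nu X Z.
Proof. exact: nu_mapE. Qed.

Lemma nu_mapE_lift (X Y : C) (Z : D) (f : hom X Y) :
  bimap (nu_functor nu) f (idm Z) = mmap (Monad (nu_monad_on Z)) f.
Proof.
apply: nu_lift_uniq1; rewrite nu_bimapE.
have -> : nu_out nu Y Z \c (nu_eta Z Y \c f) = eta (TT (nu Y Z) Z) \c f.
  by rewrite compA nu_etaE.
move: (bimap (nu_functor nu) f (idm Z)) => /= h.
rewrite -[lift _ _]/(mmap _ _) -pm_mapE [RHS]compA bimap_comp.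
by rewrite comp1m compm1.
Qed.

Lemma nu_bimap_lift (X Y : C) (Z W : D) (z : hom Z W) (f : hom X (nu Y Z)) :
  bimap (nu_functor nu) (idm Y) z \c nu_lift f =
  nu_lift (bimap (nu_functor nu) (idm Y) z \c f) \c
    bimap (nu_functor nu) (idm X) z.
Proof.
move: (nu_bimapE (idm Y) z) (nu_bimapE (idm X) z).
move: (bimap _ (idm Y) z) (bimap _ (idm X) z) => /= vY vX vYE vXE.
move: (nu_lift f) (nu_liftE f) (nu_lift _) (nu_liftE (vY \c f)).
move=> fl flE vfl vflE.
apply: (@nu_corec_eq _ _ _ _
  (bimap T (idm Y) (pairm vY z) \c (nu_out nu Y Z \c f))
  (bimap T (idm X) (pairm (idm _) z) \c nu_out nu X Z)).
  rewrite compA vYE -compA flE [LHS]compA bimap_lift -!compA.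
  congr (_ \c _); rewrite [LHS]compA [RHS]compA !bimap_comp !pairm_comp.
  by rewrite ?comp1m ?compm1.
rewrite compA vflE -!compA vXE [nu_out nu Y W \c _]compA vYE -!compA.
congr (_ \c _); rewrite [LHS]compA [RHS]compA !bimap_comp !pairm_comp.
by rewrite ?comp1m ?compm1.
Qed.

Lemma nu_bimap_morph (Z W : D) (z : hom Z W) :
  @is_monad_morphism C (Monad (nu_monad_on Z)) (Monad (nu_monad_on W))
    (fun X => bimap (nu_functor nu) (idm X) z).
Proof.
split=> [X|X Y f]; last exact: nu_bimap_lift.
by apply: nu_out_inj; rewrite compA nu_bimapE -compA !nu_etaE bimap_eta.
Qed.

Definition nu_param_monad : param_monad C D :=
  ParamMonad nu_mapE_lift nu_bimap_morph.

End NuMonad.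

Section NuGuarded.
Context (C : cocat) (D : category).
Context (T : param_guarded_monad C (prod_cat C D)) (nu : final_coalgebras T).

Local Notation TT G Z := (pgm_at T (@pair (ob C) (ob D) G Z)).

(* [f] is guarded iff [out \c f] is guarded for [(-) # (Y #^nu Z, Z)]. *)
Definition nu_grd (Z : D) (X Y : C) (s : summand Y) (f : hom X (nu Y Z)) :
  Prop := grd (TT (nu Y Z) Z) s (nu_out nu Y Z \c f).

Lemma bimap_grd (X Y : C) (P Q : prod_cat C D) (p : hom P Q) (s : summand Y)
    (f : hom X (T (Y, P))) :
  grd (pgm_at T P) s f -> grd (pgm_at T Q) s (bimap T (idm Y) p \c f).
Proof. by case: (pgm_morph T p) => _; apply. Qed.

Lemma nu_grd_trv (Z : D) (X Y V : C) (f : hom X (nu Y Z)) :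
  nu_grd (inr_smd Y V) (mmap (pm_at (nu_param_monad nu) Z) injl \c f).
Proof.
rewrite /nu_grd -(pm_mapE (nu_param_monad nu)) compA nu_bimapE.
move: (bimap _ injl (idm Z)) => /= h.
have -> : bimap T (@injl C Y V) (pairm h (idm Z)) =
    bimap T (idm _) (pairm h (idm Z)) \c bimap T injl (idm _).
  by rewrite bimap_comp comp1m compm1.
rewrite -!compA; apply: bimap_grd; rewrite pm_mapE.
exact: grd_trv_on.
Qed.

Lemma nu_grd_par (Z : D) (X Y V : C) (s : summand V)
    (f : hom X (nu V Z)) (g : hom Y (nu V Z)) :
  nu_grd s f -> nu_grd s g -> nu_grd s (copair f g).
Proof. by move=> Hf Hg; rewrite /nu_grd comp_copair; apply: grd_par_on. Qed.

Lemma nu_grd_cmp (Z : D) (X Y V W : C) (s : summand W)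
    (f : hom X (nu (cop Y V) Z)) (g : hom Y (nu W Z)) (h : hom V (nu W Z)) :
  nu_grd (inr_smd Y V) f -> nu_grd s g ->
  nu_grd s (nu_lift (copair g h) \c f).
Proof.
move=> Hf Hg; rewrite /nu_grd compA nu_liftE comp_copair -!compA.
by apply: grd_cmp_on Hg; apply: bimap_grd.
Qed.

Definition nu_guarded_on (Z : D) :
    guarded_on (pm_at (nu_param_monad nu) Z) :=
  @GuardedOn C (pm_at (nu_param_monad nu) Z)
    (fun X Y s f => nu_grd s f)
    (@nu_grd_trv Z) (@nu_grd_par Z) (@nu_grd_cmp Z).

Lemma nu_bimap_grd (Z W : D) (z : hom Z W) :
  @is_guarded_monad_morphism C (GuardedMonad (nu_guarded_on Z))
    (GuardedMonad (nu_guarded_on W))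
    (fun X => bimap (nu_param_monad nu) (idm X) z).
Proof.
split=> [|X Y s f Hf]; first exact: (pm_morph (nu_param_monad nu)).
rewrite /grd /= /nu_grd compA nu_bimapE -compA; exact: bimap_grd.
Qed.

Definition nu_param_guarded_monad : param_guarded_monad C D :=
  ParamGuardedMonad nu_bimap_grd.

End NuGuarded.

Section NuPreiterative.
Context (C : cocat) (D : category).
Context (T : param_preiterative_monad C (prod_cat C D)).
Context (nu : final_coalgebras T).

Local Notation TT G Z := (ppm_at T (@pair (ob C) (ob D) G Z)).
Local Notation nuT := (nu_param_guarded_monad nu).

(* [nu_dag] below is [coit ([eta, (out f)^dag]^* \c out) \c eta^nu \c inr]. *)
Definition nu_dag_coit (Z : D) (X Y : C)
    (u : hom X (TT (nu (cop Y X) Z) Z Y)) : hom (nu (cop Y X) Z) (nu Y Z) :=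
  @nu_coit C D T nu Y Z _
    (lift (TT (nu (cop Y X) Z) Z) (copair (eta (TT (nu (cop Y X) Z) Z)) u) \c
     nu_out nu (cop Y X) Z).

Definition nu_out_dag (Z : D) (X Y : C) (f : hom X (nu (cop Y X) Z))
    (H : nu_grd (inr_smd Y X) f) : hom X (TT (nu (cop Y X) Z) Z Y) :=
  dag (TT (nu (cop Y X) Z) Z) (f := nu_out nu (cop Y X) Z \c f) H.

Definition nu_dag (Z : D) (X Y : C) (f : hom X (nu (cop Y X) Z))
    (H : nu_grd (inr_smd Y X) f) : hom X (nu Y Z) :=
  nu_dag_coit (nu_out_dag H) \c (nu_eta nu Z (cop Y X) \c injr).

Lemma nu_dag_irr (Z : D) (X Y : C) (f : hom X (nu (cop Y X) Z))
    (H H' : nu_grd (inr_smd Y X) f) : nu_dag H = nu_dag H'.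
Proof.
by rewrite /nu_dag; congr (nu_dag_coit _ \c _); exact: dag_irr.
Qed.

Lemma nu_dag_coitE (Z : D) (X Y : C) (u : hom X (TT (nu (cop Y X) Z) Z Y)) :
  nu_out nu Y Z \c nu_dag_coit u =
  bimap T (idm Y) (pairm (nu_dag_coit u) (idm Z)) \c
    (lift (TT (nu (cop Y X) Z) Z) (copair (eta (TT (nu (cop Y X) Z) Z)) u) \c
     nu_out nu (cop Y X) Z).
Proof. exact: nu_coitE. Qed.

Lemma nu_dagE (Z : D) (X Y : C) (f : hom X (nu (cop Y X) Z))
    (H : nu_grd (inr_smd Y X) f) :
  nu_out nu Y Z \c nu_dag H =
  bimap T (idm Y) (pairm (nu_dag_coit (nu_out_dag H)) (idm Z)) \c nu_out_dag H.
Proof.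
rewrite /nu_dag; move: (nu_out_dag H) => u.
have := nu_etaE nu Z (cop Y X); move: (nu_eta nu Z _) => e eE.
rewrite compA nu_dag_coitE -!compA [nu_out _ _ _ \c _]compA eE.
by rewrite [lift _ _ \c _]compA lift_comp_eta copair_injr.
Qed.

Lemma nu_dag_fix (Z : D) (X Y : C) (f : hom X (nu (cop Y X) Z))
    (H : nu_grd (inr_smd Y X) f) :
  nu_dag H = nu_lift (copair (nu_eta nu Z Y) (nu_dag H)) \c f.
Proof.
have <- : nu_dag_coit (nu_out_dag H) =
    nu_lift (copair (nu_eta nu Z Y) (nu_dag H)).
  apply: nu_lift_uniq1; rewrite comp_copair nu_etaE nu_dagE.
  move: (nu_out_dag H) => u; move: (nu_dag_coit u) (nu_dag_coitE u) => h ->.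
  by rewrite [LHS]compA bimap_lift comp_copair bimap_eta -!compA.
apply: nu_out_inj; rewrite nu_dagE compA nu_dag_coitE -!compA.
by congr (_ \c _); exact: (dag_fix (M := TT (nu (cop Y X) Z) Z) H).
Qed.

Definition nu_preiterative_on (Z : D) : preiterative_on (pgm_at nuT Z) :=
  @PreiterativeOn C (pgm_at nuT Z) (@nu_dag Z) (@nu_dag_irr Z) (@nu_dag_fix Z).

Lemma dag_eq (P : prod_cat C D) (X Y : C) (f g : hom X (ppm_at T P (cop Y X)))
    (Hf : grd (ppm_at T P) (inr_smd Y X) f)
    (Hg : grd (ppm_at T P) (inr_smd Y X) g) :
  f = g -> dag (ppm_at T P) Hf = dag (ppm_at T P) Hg.
Proof. by move=> e; case: g / e Hg => Hg; exact: dag_irr. Qed.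

Lemma bimap_dag (P Q : prod_cat C D) (p : hom P Q) (X Y : C)
    (f : hom X (ppm_at T P (cop Y X)))
    (H : grd (ppm_at T P) (inr_smd Y X) f)
    (H' : grd (ppm_at T Q) (inr_smd Y X) (bimap T (idm (cop Y X)) p \c f)) :
  bimap T (idm Y) p \c dag (ppm_at T P) H = dag (ppm_at T Q) H'.
Proof. exact: (@ppm_morph _ _ T P Q p). Qed.

Lemma nu_map_dag (Z W : D) (z : hom Z W) (X Y : C)
    (f : hom X (nu (cop Y X) Z)) (H : nu_grd (inr_smd Y X) f)
    (H' : nu_grd (inr_smd Y X) (nu_map nu (idm (cop Y X)) z \c f)) :
  nu_map nu (idm Y) z \c nu_dag H = nu_dag H'.
Proof.
have vE := nu_mapE nu (idm (cop Y X)) z.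
set v := nu_map nu (idm (cop Y X)) z in H' vE *.
have uE : nu_out_dag H' = bimap T (idm Y) (pairm v z) \c nu_out_dag H.
  have K := bimap_grd (T := T) (pairm v z) H.
  rewrite /nu_out_dag (bimap_dag (p := pairm v z) H K); apply: dag_eq.
  by rewrite compA vE -compA.
rewrite /nu_dag uE; move: (nu_out_dag H) => u {uE}.
have veta : nu_eta nu W (cop Y X) = v \c nu_eta nu Z (cop Y X).
  by case: (nu_bimap_morph nu z) => ->.
rewrite veta {veta}.
move: (nu_mapE nu (idm Y) z); move: (nu_map _ (idm Y) z) => vY vYE.
move: (nu_eta _ _ _) => e; clearbody v.
rewrite [LHS]compA -[v \c e \c injr]compA [RHS]compA; congr (_ \c _).
set u' := bimap _ _ _ \c u.
move: (nu_dag_coit u) (nu_dag_coitE u) (nu_dag_coit u') (nu_dag_coitE u').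
rewrite {}/u' => h hE h' h'E.
apply: (@nu_coit_eq _ _ _ nu _ _ _ (bimap T (idm Y) (pairm (idm _) z) \c
  (lift (TT (nu (cop Y X) Z) Z) (copair (eta (TT (nu (cop Y X) Z) Z)) u) \c
     nu_out nu (cop Y X) Z))).
  rewrite compA vYE -compA hE [LHS]compA [RHS]compA !bimap_comp !pairm_comp.
  by rewrite !comp1m !compm1.
rewrite compA h'E -!compA vE.
have -> : lift (TT (nu (cop Y X) W) W)
      (copair (eta (TT (nu (cop Y X) W) W)) (bimap T (idm Y) (pairm v z) \c u))
      \c (bimap T (idm (cop Y X)) (pairm v z) \c nu_out nu (cop Y X) Z) =
    bimap T (idm Y) (pairm v z) \c
      (lift (TT (nu (cop Y X) Z) Z) (copair (eta (TT (nu (cop Y X) Z) Z)) u) \c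
       nu_out nu (cop Y X) Z).
  rewrite -(bimap_eta T Y (pairm v z)) -comp_copair [LHS]compA [RHS]compA.
  by rewrite bimap_lift.
rewrite [LHS]compA [RHS]compA !bimap_comp !pairm_comp.
by rewrite !comp1m !compm1.
Qed.

Lemma nu_bimap_dag (Z W : D) (z : hom Z W) :
  @preserves_iteration C (PreiterativeMonad (nu_preiterative_on Z))
    (PreiterativeMonad (nu_preiterative_on W))
    (fun X => bimap nuT (idm X) z).
Proof. by move=> X Y f H H'; exact: nu_map_dag. Qed.

Definition nu_param_preiterative_monad : param_preiterative_monad C D :=
  ParamPreiterativeMonad nu_bimap_dag.

End NuPreiterative.

Definition rho_nu (C D : category) (T S : functor (prod_cat C (prod_cat C D)) C)
    (nuT : final_coalgebras T) (nuS : final_coalgebras S)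
    (rho : forall (X : C) (P : prod_cat C D), hom (T (X, P)) (S (X, P)))
    (X : C) (Z : D) : hom (nuT X Z) (nuS X Z) :=
  nu_coit nuS (rho X (nuT X Z : C, Z) \c nu_out nuT X Z).

(* Main.v *)
(** Write [r] for [rho_nu].  Since [rho] is natural, [r] is determined by
    [out \c r = R \c out], where [R = rho \c (id # (r, id))] is a composite of
    two monad morphisms, hence one itself; all equations about [r] follow from
    this by uniqueness of coiteration.  The passage from [rho] to [r] makes
    sense for families that are not natural, and applied to a section of [rho]
    it yields a section of [r].  For the congruence, [r \c f = r \c g] says that
    [R] identifies [out \c f] and [out \c g]; as [id # (r, id)] preserves
    iteration, [R] is an iteration congruence, so [w = R \c (out \c f)^dag] is
    the same for [f] and [g].  But the composite of [r] with the iterate of [f]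
    is [coit ([eta, w]^* \c out) \c eta \c inr], which depends on [f] only
    through [w]. *)

From Corelib Require Import ssreflect ssrfun.
From Stdlib Require Import ClassicalEpsilon.
Require Import Defs.

Set Implicit Arguments.
Unset Strict Implicit.
Unset Printing Implicit Defensive.

Local Open Scope cat_scope.

Lemma monad_morphism_comp (C : category) (T S U : monad C)
    (alpha : forall X, hom (T X) (S X)) (beta : forall X, hom (S X) (U X)) :
  is_monad_morphism alpha -> is_monad_morphism beta ->
  is_monad_morphism (fun X => beta X \c alpha X).
Proof.
move=> [alpha_eta alpha_lift] [beta_eta beta_lift].
split=> [X|X Y f]; first by rewrite -compA alpha_eta.
by rewrite -compA alpha_lift compA beta_lift -!compA.
Qed.

Definition preserves_guardedness (C : cocat) (T S : guarded_monad C)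
    (alpha : forall X, hom (T X) (S X)) : Prop :=
  forall (X Y : C) (s : summand Y) (f : hom X (T Y)),
    grd T s f -> grd S s (alpha Y \c f).

Lemma iteration_congruence_comp (C : cocat) (T S : preiterative_monad C)
    (U : guarded_monad C) (alpha : forall X, hom (T X) (S X))
    (beta : forall X, hom (S X) (U X)) :
  preserves_guardedness alpha -> preserves_iteration alpha ->
  is_iteration_congruence beta ->
  is_iteration_congruence (fun X => beta X \c alpha X).
Proof.
move=> alpha_grd alpha_dag beta_congr X Y f g f_grd g_grd.
rewrite -!compA => eq_fg.
rewrite (alpha_dag _ _ _ f_grd (alpha_grd _ _ _ _ f_grd)).
rewrite (alpha_dag _ _ _ g_grd (alpha_grd _ _ _ _ g_grd)).
exact: beta_congr.
Qed.

Definition is_binatural (C E D : category) (F G : functor (prod_cat C E) D)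
    (rho : forall X P, hom (F (X, P)) (G (X, P))) : Prop :=
  forall (X Y : C) (P Q : E) (f : hom X Y) (p : hom P Q),
    rho Y Q \c bimap F f p = bimap G f p \c rho X P.

Definition nat_bimap (C E D : category) (F G : functor (prod_cat C E) D)
    (rho : forall X P, hom (F (X, P)) (G (X, P))) (X Y : C) (P Q : E)
    (f : hom X Y) (p : hom P Q) : hom (F (X, P)) (G (Y, Q)) :=
  rho Y Q \c bimap F f p.

Section NatBimap.
Context (C E D : category) (F G : functor (prod_cat C E) D).
Context (rho : forall X P, hom (F (X, P)) (G (X, P))).

Lemma nat_bimap_bimap (X Y V : C) (P Q R : E) (g : hom Y V) (q : hom Q R)
    (f : hom X Y) (p : hom P Q) :
  nat_bimap rho g q \c bimap F f p = nat_bimap rho (g \c f) (q \c p).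
Proof. by rewrite -compA bimap_comp. Qed.

Context (rho_nat : is_binatural rho).

Lemma bimap_nat_bimap (X Y V : C) (P Q R : E) (g : hom Y V) (q : hom Q R)
    (f : hom X Y) (p : hom P Q) :
  bimap G g q \c nat_bimap rho f p = nat_bimap rho (g \c f) (q \c p).
Proof. by rewrite compA -rho_nat -compA bimap_comp. Qed.

End NatBimap.

Definition is_param_monad_morphism (C E : category) (T S : param_monad C E)
    (rho : forall X P, hom (T (X, P)) (S (X, P))) : Prop :=
  is_binatural rho /\
  forall P : E,
    @is_monad_morphism C (pm_at T P) (pm_at S P) (fun X => rho X P).

Lemma param_guarded_monad_morphismW (C : cocat) (E : category)
    (T S : param_guarded_monad C E)
    (rho : forall (X : C) (P : E), hom (T (X, P)) (S (X, P))) :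
  is_param_guarded_monad_morphism rho -> is_param_monad_morphism rho.
Proof. by move=> [rho_nat rho_gm]; split=> // P; case: (rho_gm P). Qed.

Section NatBimapMonad.
Context (C E : category) (T S : param_monad C E).
Context (rho : forall X P, hom (T (X, P)) (S (X, P))).
Context (rho_morphism : is_param_monad_morphism rho).
Context (P Q : E) (p : hom P Q).

Lemma nat_bimap_morphism :
  @is_monad_morphism C (pm_at T P) (pm_at S Q)
    (fun X => nat_bimap rho (idm X) p).
Proof.
exact: (@monad_morphism_comp C (pm_at T P) (pm_at T Q) (pm_at S Q)
  _ _ (pm_morph T p) (proj2 rho_morphism Q)).
Qed.

Lemma nat_bimap_eta (X : C) :
  nat_bimap rho (idm X) p \c eta (pm_at T P) = eta (pm_at S Q).
Proof. exact: (proj1 nat_bimap_morphism). Qed.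

Lemma nat_bimap_lift (X Y : C) (f : hom X (T (Y, P))) :
  nat_bimap rho (idm Y) p \c lift (pm_at T P) f =
  lift (pm_at S Q) (nat_bimap rho (idm Y) p \c f) \c nat_bimap rho (idm X) p.
Proof. exact: (proj2 nat_bimap_morphism). Qed.

End NatBimapMonad.

Lemma nat_bimap_congruence (C : cocat) (E : category)
    (T : param_preiterative_monad C E) (S : param_guarded_monad C E)
    (rho : forall (X : C) (P : E), hom (T (X, P)) (S (X, P)))
    (P Q : E) (p : hom P Q) :
  is_param_iteration_congruence rho ->
  @is_iteration_congruence C (ppm_at T P) (pgm_at S Q)
    (fun X => nat_bimap rho (idm X) p).
Proof.
move=> rho_congr.
exact: (@iteration_congruence_comp C (ppm_at T P) (ppm_at T Q) (pgm_at S Q)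
  _ _ (proj2 (pgm_morph T p)) (@ppm_morph _ _ T P Q p) (rho_congr Q)).
Qed.

Lemma param_guarded_retraction_section (C : cocat) (E : category)
    (T S : param_guarded_monad C E)
    (rho : forall (X : C) (P : E), hom (T (X, P)) (S (X, P))) :
  is_param_guarded_retraction rho ->
  exists upsilon : forall (X : C) (P : E), hom (S (X, P)) (T (X, P)),
    (forall X P, rho X P \c upsilon X P = idm _) /\
    forall P, @preserves_guardedness C (pgm_at S P) (pgm_at T P)
      (fun X => upsilon X P).
Proof.
move=> retr.
pose sec P := constructive_indefinite_description _ (proj2 (retr P)).
exists (fun X P => proj1_sig (sec P) X).
split=> [X P|P]; first exact: (proj1 (proj2_sig (sec P))).
exact: (proj2 (proj2_sig (sec P))).
Qed.

Section RhoNuFunctor.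
Context (C D : category) (T S : functor (prod_cat C (prod_cat C D)) C).
Context (nuT : final_coalgebras T) (nuS : final_coalgebras S).
Context (rho : forall (X : C) (P : prod_cat C D), hom (T (X, P)) (S (X, P))).

Local Notation r := (rho_nu nuT nuS rho).

Lemma rho_nuE (X : C) (Z : D) :
  nu_out nuS X Z \c r X Z =
  bimap S (idm X) (pairm (r X Z) (idm Z)) \c
    (rho X (nuT X Z : C, Z) \c nu_out nuT X Z).
Proof. exact: nu_coitE. Qed.

Context (rho_nat : is_binatural rho).

Lemma rho_nuE_nat (X : C) (Z : D) :
  nu_out nuS X Z \c r X Z =
  nat_bimap rho (idm X) (pairm (r X Z) (idm Z)) \c nu_out nuT X Z.
Proof. by rewrite rho_nuE compA -rho_nat. Qed.

Lemma rho_nu_coit (X A : C) (Z : D) (a : hom A (T (X, (A, Z)))) :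
  r X Z \c nu_coit nuT a = nu_coit nuS (rho X (A, Z) \c a).
Proof.
apply: nu_coit_uniq; rewrite compA rho_nuE_nat -compA nu_coitE.
by rewrite compA nat_bimap_bimap pairm_comp !comp1m compA -rho_nat.
Qed.

Lemma rho_nu_natural :
  is_binatural (F := nu_functor nuT) (G := nu_functor nuS) r.
Proof.
move=> X Y Z W f z; rewrite /bimap /=.
apply: (@nu_coit_eq _ _ _ nuS _ _ _
  (nat_bimap rho f (pairm (idm _) z) \c nu_out nuT X Z)).
  rewrite compA rho_nuE_nat -compA nu_mapE [LHS]compA [RHS]compA.
  by rewrite nat_bimap_bimap bimap_nat_bimap // !pairm_comp !comp1m compm1.
rewrite compA nu_mapE -compA rho_nuE_nat [LHS]compA [RHS]compA.
by rewrite !bimap_nat_bimap // !pairm_comp !comp1m !compm1.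
Qed.

Lemma rho_nuK (upsilon : forall (X : C) (P : prod_cat C D),
    hom (S (X, P)) (T (X, P))) (X : C) (Z : D) :
  (forall X P, rho X P \c upsilon X P = idm _) ->
  r X Z \c rho_nu nuS nuT upsilon X Z = idm _.
Proof.
move=> upsilonK; rewrite rho_nu_coit compA upsilonK comp1m.
by apply/esym/nu_coit_uniq; rewrite bimap_id comp1m compm1.
Qed.

End RhoNuFunctor.

Definition nu_coit_lift (C D : category) (T : param_monad C (prod_cat C D))
    (nu : final_coalgebras T) (V Y : C) (Z : D)
    (u : hom V (T (Y, (nu V Z : C, Z)))) : hom (nu V Z) (nu Y Z) :=
  nu_coit nu (lift (pm_at T (nu V Z : C, Z)) u \c nu_out nu V Z).

Section RhoNuMonad.
Context (C : cocat) (D : category) (T S : param_monad C (prod_cat C D)).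
Context (nuT : final_coalgebras T) (nuS : final_coalgebras S).
Context (rho : forall (X : C) (P : prod_cat C D), hom (T (X, P)) (S (X, P))).
Context (rho_morphism : is_param_monad_morphism rho).

Local Notation r := (rho_nu nuT nuS rho).

Let rho_nat : is_binatural rho := proj1 rho_morphism.

Lemma rho_nu_eta (X : C) (Z : D) : r X Z \c nu_eta nuT Z X = nu_eta nuS Z X.
Proof.
apply: nu_out_inj.
by rewrite compA rho_nuE_nat // -compA !nu_etaE nat_bimap_eta.
Qed.

Lemma rho_nu_lift (X Y : C) (Z : D) (f : hom X (nuT Y Z)) :
  r Y Z \c nu_lift f = nu_lift (r Y Z \c f) \c r X Z.
Proof.
apply: (@nu_corec_eq _ _ _ nuS _ _ _ _ (nu_out nuS Y Z \c (r Y Z \c f))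
  (rho X (nuT X Z : C, Z) \c nu_out nuT X Z)).
  rewrite compA rho_nuE_nat // -compA nu_liftE [LHS]compA nat_bimap_lift //.
  rewrite -compA [nat_bimap _ _ _ \c (nu_out _ _ _ \c f)]compA -rho_nuE_nat //.
  rewrite -compA; congr (_ \c _); rewrite [LHS]compA [RHS]compA.
  by rewrite nat_bimap_bimap -rho_nat pairm_comp !comp1m.
rewrite compA nu_liftE -2!compA rho_nuE_nat //; congr (_ \c _).
by rewrite [LHS]compA [RHS]compA bimap_nat_bimap // -rho_nat pairm_comp !comp1m.
Qed.

Lemma rho_nu_coit_lift (V Y : C) (Z : D)
    (u : hom V (T (Y, (nuT V Z : C, Z)))) :
  r Y Z \c nu_coit_lift u =
  nu_coit_lift (nat_bimap rho (idm Y) (pairm (r V Z) (idm Z)) \c u) \c r V Z.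
Proof.
rewrite rho_nu_coit //; apply/esym/nu_coit_uniq.
rewrite compA nu_coitE -compA -[_ \c r V Z]compA rho_nuE_nat //.
rewrite [lift _ _ \c (_ \c nu_out nuT _ _)]compA -nat_bimap_lift //.
rewrite -[_ \c nu_out nuT _ _]compA [LHS]compA [RHS]compA.
by rewrite bimap_nat_bimap // -rho_nat pairm_comp !comp1m.
Qed.

End RhoNuMonad.

Lemma rho_nu_grd (C : cocat) (D : category)
    (T S : param_guarded_monad C (prod_cat C D))
    (nuT : final_coalgebras T) (nuS : final_coalgebras S)
    (rho : forall (X : C) (P : prod_cat C D), hom (T (X, P)) (S (X, P))) :
  (forall P, @preserves_guardedness C (pgm_at T P) (pgm_at S P)
     (fun X => rho X P)) ->
  forall Z : D, @preserves_guardedness C (pgm_at (nu_param_guarded_monad nuT) Z)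
    (pgm_at (nu_param_guarded_monad nuS) Z)
    (fun X => rho_nu nuT nuS rho X Z).
Proof.
move=> rho_grd Z X Y s f f_grd.
rewrite /grd /= /nu_grd compA rho_nuE -!compA.
by apply: bimap_grd; apply: rho_grd.
Qed.

Section RhoNuGuarded.
Context (C : cocat) (D : category).
Context (T S : param_guarded_monad C (prod_cat C D)).
Context (nuT : final_coalgebras T) (nuS : final_coalgebras S).
Context (rho : forall (X : C) (P : prod_cat C D), hom (T (X, P)) (S (X, P))).
Context (rho_morphism : is_param_guarded_monad_morphism rho).

Local Notation r := (rho_nu nuT nuS rho).

Lemma rho_nu_morphism :
  is_param_guarded_monad_morphism
    (T := nu_param_guarded_monad nuT) (S := nu_param_guarded_monad nuS) r.
Proof.
have rho_mor := param_guarded_monad_morphismW rho_morphism.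
split=> [X Y Z W f z|Z]; first exact: (rho_nu_natural _ _ (proj1 rho_mor)).
split; first by split=> [X|X Y f]; [exact: rho_nu_eta|exact: rho_nu_lift].
by apply: rho_nu_grd => P; case: rho_morphism => _ /(_ P) [].
Qed.

Lemma rho_nu_retraction :
  is_param_guarded_retraction rho ->
  is_param_guarded_retraction
    (T := nu_param_guarded_monad nuT) (S := nu_param_guarded_monad nuS) r.
Proof.
move=> /param_guarded_retraction_section[upsilon [upsilonK upsilon_grd]] Z.
split; first by case: rho_nu_morphism => _ /(_ Z) [].
(* The component at [X] uses the section for the parameter [(nuS X Z, Z)], which
   varies with [X]: hence the choice of [upsilon] for all parameters at once. *)
exists (fun X => rho_nu nuS nuT upsilon X Z).
split=> [X|]; first exact: (rho_nuK _ _ (proj1 rho_morphism)).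
exact: (rho_nu_grd nuT upsilon_grd).
Qed.

End RhoNuGuarded.

Section RhoNuPreiterative.
Context (C : cocat) (D : category).
Context (T : param_preiterative_monad C (prod_cat C D)).
Context (S : param_guarded_monad C (prod_cat C D)).
Context (nuT : final_coalgebras T) (nuS : final_coalgebras S).
Context (rho : forall (X : C) (P : prod_cat C D), hom (T (X, P)) (S (X, P))).
Context (rho_morphism : is_param_monad_morphism rho).

Local Notation r := (rho_nu nuT nuS rho).
Local Notation R V Y Z := (nat_bimap rho (idm Y) (pairm (r V Z) (idm Z))).

Lemma rho_nu_dag (X Y : C) (Z : D) (f : hom X (nuT (cop Y X) Z))
    (f_grd : nu_grd (inr_smd Y X) f) :
  r Y Z \c nu_dag f_grd =
  nu_coit_lift
      (copair (eta (pm_at S (_, Z))) (R (cop Y X) Y Z \c nu_out_dag f_grd)) \c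
    (nu_eta nuS Z (cop Y X) \c injr).
Proof.
(* [nu_dag_coit u] is convertible to [nu_coit_lift (copair eta u)]. *)
have r_coit := rho_nu_coit_lift nuS rho_morphism
  (copair (eta (pm_at T (nuT (cop Y X) Z : C, Z))) (nu_out_dag f_grd)).
rewrite [LHS]compA [X in X \c _ = _]r_coit comp_copair nat_bimap_eta //.
by rewrite -[LHS]compA [r _ _ \c _]compA rho_nu_eta.
Qed.

Lemma rho_nu_congruence :
  is_param_iteration_congruence rho ->
  is_param_iteration_congruence
    (T := nu_param_preiterative_monad nuT) (S := nu_param_guarded_monad nuS) r.
Proof.
move=> rho_congr Z X Y f g f_grd g_grd rfg.
have Rout h : R (cop Y X) (cop Y X) Z \c (nu_out nuT (cop Y X) Z \c h) =
    nu_out nuS (cop Y X) Z \c (r (cop Y X) Z \c h) :> hom X _.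
  by rewrite [LHS]compA -(rho_nuE_nat _ _ (proj1 rho_morphism)) -compA.
have Rdag : R (cop Y X) Y Z \c nu_out_dag f_grd =
    R (cop Y X) Y Z \c nu_out_dag g_grd.
  have R_congr :=
    nat_bimap_congruence (p := pairm (r (cop Y X) Z) (idm Z)) rho_congr.
  by apply: (R_congr X Y _ _ f_grd g_grd); rewrite [LHS]Rout rfg -Rout.
by rewrite [LHS]rho_nu_dag Rdag -rho_nu_dag.
Qed.

End RhoNuPreiterative.

Theorem theorem5p10 (C : cocat) (D : category)
    (T : param_preiterative_monad C (prod_cat C D))
    (S : param_guarded_monad C (prod_cat C D))
    (rho : forall (X : C) (P : prod_cat C D), hom (T (X, P)) (S (X, P)))
    (rho_morphism : is_param_guarded_monad_morphism rho)
    (rho_retraction : is_param_guarded_retraction rho)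
    (rho_congruence : is_param_iteration_congruence rho)
    (nuT : final_coalgebras T) (nuS : final_coalgebras S) :
  is_param_guarded_monad_morphism
    (T := nu_param_guarded_monad nuT) (S := nu_param_guarded_monad nuS)
    (rho_nu nuT nuS rho) /\
  is_param_guarded_retraction
    (T := nu_param_guarded_monad nuT) (S := nu_param_guarded_monad nuS)
    (rho_nu nuT nuS rho) /\
  is_param_iteration_congruence
    (T := nu_param_preiterative_monad nuT) (S := nu_param_guarded_monad nuS)
    (rho_nu nuT nuS rho).
Proof.
split; first exact: rho_nu_morphism.
split; first exact: rho_nu_retraction.
exact: rho_nu_congruence (param_guarded_monad_morphismW rho_morphism) _.
Qed.
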